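(* Let $M$ be a compact Riemannian manifold and $E$ a vector bundle over $M$. Let $\nabla$ be a minimizer in $\mathcal W(E)$ of the Yang-Mills functional $\mathcal{YM}$, and suppose the norm $\|R^\nabla\|$ is constant almost everywhere. Then the same connection $\nabla$ is a minimizer of the normalized exponential Yang-Mills functional $\mathcal{YM}_e^0$ in $\mathcal W(E)$, and for any minimizer $\tilde\nabla$ of $\mathcal{YM}_e^0$ in $\mathcal W(E)$, the norm $\|R^{\tilde\nabla}\|$ is almost everywhere constant.
   Context: $E$ is equipped with a fiber metric. For a connection $\nabla$ on $E$, $R^\nabla$ is its curvature and, at $x\in M$, $\|R^\nabla\|^2=\sum_{i<j}\|R^\nabla_{e_i,e_j}\|^2$ for an orthonormal basis $\{e_i\}$ of $T_xM$, with the norm on $\mathrm{Hom}(E,E)$ given by $\langle S,U\rangle=\mathrm{trace}(S^T\circ U)$. The Yang-Mills functional is $\mathcal{YM}(\nabla)=\int_M\frac12\|R^\nabla\|^2dv$, and the normalized exponential Yang-Mills functional is $\mathcal{YM}_e^0(\nabla)=\int_M\big(\exp(\frac12\|R^\nabla\|^2)-1\big)dv$. $\mathcal L_1^p(E)$ denotes the Sobolev space of connections of $E$ which are $p$-integrable together with their first derivatives, and $$\mathcal W(E)=\bigcap_{p\ge1}\mathcal L_1^p(E)\cap\{\nabla:\mathcal{YM}_e^0(\nabla)<\infty\}.$$ A minimizer in $\mathcal W(E)$ of a functional is an element of $\mathcal W(E)$ at which the functional attains its infimum over $\mathcal W(E)$. *)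

(* Defs.v *)
From HB Require Import structures.
From mathcomp Require Import all_boot all_order all_algebra.
From mathcomp Require Import all_classical all_reals all_analysis.
Import Order.TTheory GRing.Theory Num.Theory.
Import numFieldNormedType.Exports.

Set Implicit Arguments.
Unset Strict Implicit.
Unset Printing Implicit Defensive.

Local Open Scope classical_set_scope.
Local Open Scope ring_scope.

Notation borel T := (g_sigma_algebraType (@open T)).

Section lebesgue_rV.
Context {R : realType}.

Lemma measurable_fun_rV d (T : measurableType d) n (f : T -> 'rV[R]_n) :
  (forall j, measurable_fun [set: T] (fun x => f x 0 j)) ->
  measurable_fun [set: T] (f : T -> borel 'rV[R]_n).
Proof.
move=> mf.
apply: (@measurability _ _ T (borel 'rV[R]_n) setT f (@open 'rV[R]_n)) => //= _ [U oU <-].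
rewrite setTI.
pose B (q : 'rV[rat]_n * nat) : set T :=
  \bigcap_(j in [set: 'I_n])
    [set x | `|ratr (q.1 0 j) - f x 0 j| < (q.2.+1%:R : R)^-1].
pose S : set ('rV[rat]_n * nat) :=
  [set q | ball (map_mx ratr q.1 : 'rV[R]_n) ((q.2.+1%:R : R)^-1) `<=` U].
have -> : f @^-1` U = \bigcup_(q in S) B q.
  apply/seteqP; split=> [x Ux|x [q Sq Bqx]] /=.
  - have : nbhs (f x) U by apply: open_nbhs_nbhs; split.
    move/nbhs_ballP => [e /= e0 exU].
    have [m me] : exists m, (m.+1%:R : R)^-1 < e / 2.
      have := @near_infty_natSinv_lt R (PosNum (divr_gt0 e0 (ltr0Sn R 1))).
      by move=> [m _ /(_ m (leqnn m))] /= ?; exists m.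
    have /choice[q qP] : forall j, exists q : rat,
        `|ratr q - f x 0 j| < (m.+1%:R : R)^-1.
      move=> j.
      have [q] := @rat_in_itvoo R (f x 0 j - (m.+1%:R)^-1) (f x 0 j + (m.+1%:R)^-1)
        ltac:(by rewrite ltrBlDr -addrA ltrDl addr_gt0 ?invr_gt0).
      rewrite in_itv/= => /andP[q1 q2]; exists q.
      by rewrite ltr_distl q1 q2.
    exists (\row_j q j, m) => /=.
    + move=> y /= [_ hy]; apply: exU; split=> // i j.
      rewrite /ball/= (ord1 i).
      have := hy 0 j; rewrite /ball/= !mxE => hq.
      have := qP j => hq2.
      rewrite (splitr e) -(subrKA (ratr (q j))).
      rewrite (le_lt_trans (ler_normD _ _))// ltrD//.
        by rewrite distrC (lt_trans hq2).
      by rewrite (lt_trans hq).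
    + by move=> j _ /=; rewrite mxE.
  - apply: (Sq (f x)); split=> [|i j]; first by rewrite invr_gt0.
     rewrite (ord1 i) /ball/= mxE.
    exact: Bqx.
rewrite bigcup_mkcond; apply: countable_bigcupT_measurable => // q.
case: ifPn => // _.
apply: fin_bigcap_measurable => // j _.
have -> : [set x | `|ratr (q.1 0 j) - f x 0 j| < (q.2.+1%:R : R)^-1] =
   [set: T] `&` (fun x => f x 0 j) @^-1` (ball (ratr (q.1 0 j) : R) (q.2.+1%:R)^-1).
  by rewrite setTI.
apply: mf => //; apply: measurable_realfun.open_measurable.
by apply: ball_open; rewrite invr_gt0.
Qed.


Lemma measurable_coord_rV n (j : 'I_n) :
  measurable_fun [set: borel 'rV[R]_n] (fun v : borel 'rV[R]_n => v 0 j).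
Proof.
apply: (measurability _ (measurable_realfun.RGenOpens.measurableE R)) => _ [_ [a [b ->]] <-].
rewrite setTI; apply: sub_sigma_algebra.
by apply: open_comp => // v _; exact: coord_continuous.
Qed.

Definition cons_rV n (p : measurableTypeR R * borel 'rV[R]_n) :
    borel 'rV[R]_n.+1 :=
  row_mx (p.1%:M : 'rV_1) p.2.

Definition uncons_rV n (v : borel 'rV[R]_n.+1) :
    measurableTypeR R * borel 'rV[R]_n :=
  (v 0 ord0, rsubmx (v : 'rV_(1 + n))).

Lemma cons_rVK n : cancel (@cons_rV n) (@uncons_rV n).
Proof.
move=> [a v]; rewrite /uncons_rV /cons_rV row_mxKr; congr pair => /=.
have -> : (ord0 : 'I_n.+1) = lshift n (ord0 : 'I_1) by apply/val_inj.
by rewrite (@row_mxEl _ _ 1 n) mxE eqxx.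
Qed.

Lemma measurable_cons_rV n :
  measurable_fun setT (@cons_rV n).
Proof.
apply: measurable_fun_rV => j.
case: (@split_ordP 1 n j) => k ->.
- have -> : (fun x : measurableTypeR R * borel 'rV[R]_n =>
      (cons_rV x) 0 (lshift n k)) = fst.
    by apply/funext => x; rewrite /cons_rV (@row_mxEl _ _ 1 n) mxE (ord1 k) eqxx.
  exact: measurable_fst.
- have -> : (fun x : measurableTypeR R * borel 'rV[R]_n =>
      (cons_rV x) 0 (rshift 1 k)) = (fun v : borel 'rV[R]_n => v 0 k) \o snd.
    by apply/funext => x; rewrite /cons_rV (@row_mxEr _ _ 1 n).
  exact: (measurableT_comp (measurable_coord_rV k) measurable_snd).
Qed.

Lemma measurable_uncons_rV n :
  measurable_fun setT (@uncons_rV n).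
Proof.
apply/measurable_fun_pairP; split; first exact: measurable_coord_rV.
apply: measurable_fun_rV => j.
have -> : (fun v : borel 'rV[R]_n.+1 => (snd \o @uncons_rV n) v 0 j) =
    (fun v => v 0 (rshift 1 j)) by apply/funext => v; rewrite /= mxE.
exact: measurable_coord_rV.
Qed.

Section step.
Variables (n : nat) (mu : {sigma_finite_measure set (borel 'rV[R]_n) -> \bar R}).

Let m : {measure set _ -> \bar R} := (@lebesgue_measure R \x mu)%E.

Definition cons_measure : set (borel 'rV[R]_n.+1) -> \bar R :=
  pushforward m (@cons_rV n).

Let mcons A : measurable A -> measurable (@cons_rV n @^-1` A).
Proof.
by move=> mA; rewrite -[X in measurable X]setTI; exact: measurable_cons_rV.
Qed.

Let cons_measure0 : cons_measure set0 = 0%E.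
Proof. by rewrite /cons_measure /pushforward preimage_set0 measure0. Qed.

Let cons_measure_ge0 A : (0 <= cons_measure A)%E.
Proof. by rewrite /cons_measure /pushforward; apply: (measure_ge0 m). Qed.

Let cons_measure_sigma_additive : semi_sigma_additive cons_measure.
Proof.
move=> F mF tF mUF; rewrite /cons_measure /pushforward preimage_bigcup.
apply: measure_semi_sigma_additive.
- by move=> k; exact: mcons.
- apply/trivIsetP => /= i j _ _ ij; rewrite -preimage_setI.
  by move/trivIsetP : tF => /(_ _ _ _ _ ij) ->//; rewrite preimage_set0.
- by rewrite -preimage_bigcup; exact: mcons.
Qed.

HB.instance Definition _ := isMeasure.Build _ _ _ cons_measure
  cons_measure0 cons_measure_ge0 cons_measure_sigma_additive.

Let cons_measure_sigma_finite : sigma_finite setT cons_measure.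
Proof.
have /sigma_finiteP[F [TF ndF Foo]] := sigma_finiteT (@lebesgue_measure R).
have /sigma_finiteP[G [TG ndG Goo]] := sigma_finiteT mu.
have TFG : setT = \bigcup_k (F k `*` G k).
  rewrite -setXTT TF TG predeqE => -[x y]; split; last first.
    by move=> [k _ []/= ? ?]; split; exists k.
  move=> [/= [k _ Fx] [l _ Gy]]; exists (maxn k l) => //; split.
  - by move: x Fx; exact/subsetPset/ndF/leq_maxl.
  - by move: y Gy; exact/subsetPset/ndG/leq_maxr.
exists (fun k => @uncons_rV n @^-1` (F k `*` G k)).
  by rewrite -preimage_bigcup -TFG preimage_setT.
move=> k; have [mF Fk] := Foo k; have [mG Gk] := Goo k.
have mFG : measurable (F k `*` G k) by exact: measurableX.
split.
  by rewrite -[X in measurable X]setTI; exact: measurable_uncons_rV.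
rewrite /cons_measure /pushforward -comp_preimage.
rewrite (_ : @uncons_rV n \o @cons_rV n = id); last first.
  by apply/funext => p; exact: cons_rVK.
rewrite preimage_id.
have -> : m (F k `*` G k) = (lebesgue_measure (F k) * mu (G k))%E.
  exact: product_measure1E.
by rewrite lte_mul_pinfty// ge0_fin_numE.
Qed.

HB.instance Definition _ := Measure_isSigmaFinite.Build _ _ _ cons_measure
  cons_measure_sigma_finite.

End step.

(* n-dimensional Lebesgue measure, as an iterated product. *)
Fixpoint lebesgue_rV n : {sigma_finite_measure set (borel 'rV[R]_n) -> \bar R} :=
  match n with
  | 0 => \d_(0 : borel 'rV[R]_0)
  | k.+1 => cons_measure (lebesgue_rV k)
  end.

End lebesgue_rV.

Section calculus.
Context {R : realType}.

Definition partial (V : normedModType R) n (j : 'I_n) (f : 'rV[R]_n -> V) :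
    'rV[R]_n -> V :=
  'D_(delta_mx 0 j) f.

(* [Om] is meant to be open in the next two definitions. *)
Fixpoint Ck (V : normedModType R) n (k : nat) (Om : set 'rV[R]_n)
    (f : 'rV[R]_n -> V) : Prop :=
  match k with
  | 0 => forall y, Om y -> {for y, continuous f}
  | k'.+1 => [/\ forall y, Om y -> {for y, continuous f},
                 forall j y, Om y -> derivable f y (delta_mx 0 j)
               & forall j, Ck k' Om (partial j f)]
  end.

Definition smooth_on (V : normedModType R) n (Om : set 'rV[R]_n)
    (f : 'rV[R]_n -> V) : Prop :=
  forall k, Ck k Om f.

Definition test_function n (Om : set 'rV[R]_n) (phi : 'rV[R]_n -> R) : Prop :=
  smooth_on setT phi /\
  exists K : set 'rV[R]_n,
    [/\ compact K, K `<=` Om & forall y, ~ K y -> phi y = 0].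

Definition Lp_loc n (p : R) (Om : set 'rV[R]_n)
    (u : borel 'rV[R]_n -> R) : Prop :=
  measurable_fun (Om : set (borel 'rV[R]_n)) u /\
  forall K : set 'rV[R]_n, compact K -> K `<=` Om ->
    (\int[lebesgue_rV n]_(y in K) (`|u y| `^ p)%:E < +oo)%E.

Definition is_weak_partial n (j : 'I_n) (Om : set 'rV[R]_n)
    (u v : borel 'rV[R]_n -> R) : Prop :=
  [/\ Lp_loc 1 Om u, Lp_loc 1 Om v &
    forall phi : 'rV[R]_n -> R, test_function Om phi ->
      (\int[lebesgue_rV n]_(y in Om) (u y * partial j phi y)%:E =
       - \int[lebesgue_rV n]_(y in Om) (v y * phi y)%:E)%E].

(* A representative of the weak derivative, and 0 if there is none: weak
   derivatives are unique up to a Lebesgue-null set. *)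
Definition weak_partial n (j : 'I_n) (Om : set 'rV[R]_n)
    (u : borel 'rV[R]_n -> R) :
    borel 'rV[R]_n -> R :=
  xget (cst 0) [set v | is_weak_partial j Om u v].

Definition W1p_loc n (p : R) (Om : set 'rV[R]_n)
    (u : borel 'rV[R]_n -> R) : Prop :=
  Lp_loc p Om u /\
  forall j, exists2 v, is_weak_partial j Om u v & Lp_loc p Om v.

End calculus.

(* The atlas is finite, which is no restriction on a compact manifold, nor is
   the requirement below that bundles be trivial over its charts: atlases can
   be refined, and no notion below depends on the atlas within its smooth
   structure. *)
Record smooth_atlas (R : realType) (M : ptopologicalType) (n : nat) :=
  SmoothAtlas {
  chart : finType ;
  cdom : chart -> set M ;
  cmap : chart -> M -> 'rV[R]_n ;
  cinv : chart -> 'rV[R]_n -> M ;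
  cimg := fun i => cmap i @` cdom i ;
  cover_cdom : forall x, exists i, cdom i x ;
  open_cdom : forall i, open (cdom i) ;
  open_cimg : forall i, open (cimg i) ;
  cmapK : forall i x, cdom i x -> cinv i (cmap i x) = x ;
  continuous_cmap : forall i, {within cdom i, continuous (cmap i)} ;
  continuous_cinv : forall i, {within cimg i, continuous (cinv i)} ;
  smooth_transition : forall i j,
    smooth_on (cmap i @` (cdom i `&` cdom j)) (cmap j \o cinv i)
}.

Section geometry.
Context {R : realType} {M : ptopologicalType} {n : nat}
  (X : smooth_atlas R M n).

Definition overlap (i j : chart X) : set 'rV[R]_n :=
  cmap i @` (cdom i `&` cdom j).

Definition transition (i j : chart X) : 'rV[R]_n -> 'rV[R]_n :=
  cmap j \o cinv i.

(* [gmx i y] is the Gram matrix at the point [cinv i y] of the coordinate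
   vector fields of the chart [i].  A tangent vector is the row of its
   coordinates in a chart, so coordinates change by [v *m 'J _ _]. *)
Record riemannian_metric := RiemannianMetric {
  gmx : chart X -> 'rV[R]_n -> 'M[R]_n ;
  gmx_sym : forall i y, cimg i y -> (gmx i y)^T = gmx i y ;
  gmx_posdef : forall i y, cimg i y ->
    forall v : 'rV[R]_n, v != 0 -> 0 < (v *m gmx i y *m v^T) 0 0 ;
  gmx_smooth : forall i, smooth_on (cimg i) (gmx i) ;
  gmx_transition : forall i j y, overlap i j y ->
    gmx i y = 'J (transition i j) y *m gmx j (transition i j y)
              *m ('J (transition i j) y)^T
}.

(* The measure [sqrt (det g) dy] in every chart: since the charts cover [M],
   there is exactly one such measure on the Borel sets. *)
Definition is_riemannian_volume (g : riemannian_metric)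
    (vol : {measure set (borel M) -> \bar R}) : Prop :=
  forall (i : chart X) (B : set (borel M)), measurable B -> B `<=` cdom i ->
    vol B = (\int[lebesgue_rV n]_(y in cmap i @` B)
               (Num.sqrt (\det (gmx g i y)))%:E)%E.

(* Real vector bundles of rank [r], given by their fibers and by local
   trivializations with smooth transition functions. *)
Record vector_bundle (r : nat) := VectorBundle {
  fiber : M -> lmodType R ;
  frame : forall (i : chart X) x, {linear 'cV[R]_r -> fiber x} ;
  coord : forall (i : chart X) x, {linear fiber x -> 'cV[R]_r} ;
  frameK : forall i x, cdom i x -> cancel (frame i x) (coord i x) ;
  coordK : forall i x, cdom i x -> cancel (coord i x) (frame i x) ;
  frame_change := fun i j x =>
    \matrix_(a < r, b < r) coord j x (frame i x (delta_mx b 0)) a 0 ;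
  smooth_frame_change : forall i j,
    smooth_on (overlap i j) (fun y => frame_change i j (cinv i y))
}.

Section bundle.
Context {r : nat} (E : vector_bundle r).

Record fiber_metric := FiberMetric {
  inner : forall x, fiber E x -> fiber E x -> R ;
  innerDZl : forall x a (u v w : fiber E x),
    inner (a *: u + v) w = a * inner u w + inner v w ;
  innerC : forall x (u v : fiber E x), inner u v = inner v u ;
  inner_gt0 : forall x (u : fiber E x), u != 0 -> 0 < inner u u ;
  gram := fun (i : chart X) x =>
    \matrix_(a < r, b < r)
      inner (frame E i x (delta_mx a 0)) (frame E i x (delta_mx b 0)) ;
  smooth_gram : forall i, smooth_on (cimg i) (fun y => gram i (cinv i y))
}.

(* A connection, given by its local connection forms: on the components
   [s : 'rV_n -> 'cV_r] of a section in the frame over the chart [i], its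
   derivative along the [k]-th coordinate vector field is
   [partial k s y + cform i k y *m s y].  Compatibility of these expressions
   over the overlaps of charts is required almost everywhere, since connection
   forms of Sobolev class are only defined up to null sets.  Connections need
   not be compatible with a fiber metric. *)
Record connection := Connection {
  cform : chart X -> 'I_n -> 'rV[R]_n -> 'M[R]_r ;
  cform_gauge : forall i j k,
    {ae lebesgue_rV n, forall y : borel 'rV[R]_n, overlap i j y ->
      let T z := frame_change E i j (cinv i z) in
      T y *m cform i k y =
      partial k T y +
      (\sum_(l < n) ('J (transition i j) y) k l
                      *: cform j l (transition i j y)) *m T y}
}.

(* Membership in the Sobolev space L^p_1(E).  Since M is compact, this can be
   tested on the compact subsets of the charts. *)
Definition sobolev_connection (p : R) (D : connection) : Prop :=
  forall (i : chart X) (k : 'I_n) (a b : 'I_r),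
    W1p_loc p (cimg i) (fun y => cform D i k y a b).

Definition cform_partial (D : connection) (i : chart X) (k l : 'I_n)
    (y : 'rV[R]_n) : 'M[R]_r :=
  \matrix_(a < r, b < r)
    weak_partial k (cimg i) (fun z => cform D i l z a b) y.

(* The curvature endomorphism R_{u,v} at [cinv i y], for the tangent vectors
   with coordinates [u] and [v] in the chart [i], in the frame over [i]. *)
Definition curvature (D : connection) (i : chart X) (y u v : 'rV[R]_n) :
    'M[R]_r :=
  \sum_(k < n) \sum_(l < n) (u 0 k * v 0 l) *:
    (cform_partial D i k l y - cform_partial D i l k y
     + cform D i k y *m cform D i l y - cform D i l y *m cform D i k y).

(* trace (S^T o U), where the transpose is the adjoint with respect to the
   inner product [u^T *m H *m v] on the fiber. *)
Definition hom_inner (H S U : 'M[R]_r) : R :=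
  \tr ((invmx H *m S^T *m H) *m U).

(* The rows are the coordinates of an orthonormal basis for the inner product
   with Gram matrix [G]. *)
Definition orthonormal_basis (G : 'M[R]_n) : 'M[R]_n :=
  xget 0 [set P | P *m G *m P^T = 1%:M].

Context (g : riemannian_metric) (h : fiber_metric).

Definition curvature_normsq_in (D : connection) (i : chart X) (x : M) : R :=
  let y := cmap i x in
  let e := orthonormal_basis (gmx g i y) in
  \sum_(a < n) \sum_(b < n | (a < b)%N)
    hom_inner (gram h i x) (curvature D i y (row a e) (row b e))
                           (curvature D i y (row a e) (row b e)).

(* Computed in one of the charts at [x]; up to a null set the result does not
   depend on the chart. *)
Definition curvature_norm (D : connection) (x : M) : R :=
  if [pick i : chart X | `[< cdom i x >]] is Some i
  then Num.sqrt (curvature_normsq_in D i x) else 0.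

Context (vol : {measure set (borel M) -> \bar R}).

Definition YM (D : connection) : \bar R :=
  (\int[vol]_x (2^-1 * curvature_norm D x ^+ 2)%:E)%E.

Definition YMe0 (D : connection) : \bar R :=
  (\int[vol]_x (expR (2^-1 * curvature_norm D x ^+ 2) - 1)%:E)%E.

Definition W_space : set connection :=
  [set D | (forall p, 1 <= p -> sobolev_connection p D) /\ (YMe0 D < +oo)%E].

Definition is_minimizer (F : connection -> \bar R) (D : connection) : Prop :=
  W_space D /\ F D = ereal_inf (F @` W_space).

Definition ae_constant_curvature_norm (D : connection) : Prop :=
  exists c : R, {ae vol, forall x, curvature_norm D x = c}.

End bundle.
End geometry.

(* Main.v *)
Require Import Defs.
From HB Require Import structures.
From mathcomp Require Import all_boot all_order all_algebra.
From mathcomp Require Import all_classical all_reals all_analysis.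
From mathcomp Require Import measurable_realfun ring.
Import Order.TTheory GRing.Theory Num.Theory.
Import numFieldNormedType.Exports.

Local Open Scope classical_set_scope.
Local Open Scope ring_scope.

Set Implicit Arguments.
Unset Strict Implicit.
Unset Printing Implicit Defensive.

(** With f the energy density [2^-1 * curvature_norm ^+ 2], the normalized
    exponential functional is the integral of [expR f - 1] and the Yang-Mills
    functional that of f, so the theorem is the equality case of Jensen's
    inequality.  If f equals c almost everywhere for the Yang-Mills minimizer D,
    then, for any competitor D' with density f', the tangent line of the
    exponential at c gives
      expR f' - 1 >= (expR c - 1) + expR c * (f' - c),
    and integrating it bounds the exponential energy of D' below by that of D,
    since the integral of f' is at least the integral of c
    ([expR_jensen]).  If D' minimizes as well, the integral of the nonnegative
    gap between the two sides vanishes, so the gap vanishes almost everywhere;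
    the exponential being strictly convex, f' = c there ([expR_jensen_eq]).

    Constants can be cancelled in this computation because the exponential
    energy of D, which is expR c - 1 times the volume, is finite by assumption
    and dominates c times the volume.

    Integrals are additive, and a vanishing integral forces a function to
    vanish almost everywhere, only for measurable functions.  So the remaining
    work is the measurability of the curvature norm
    ([measurable_curvature_norm]).  It is not immediate, because the norm is
    computed in orthonormal bases that are chosen arbitrarily, point by point.
    The sum over an orthonormal basis is therefore rewritten as the contraction
    of the curvature components with the inverse of the Gram matrix of the
    metric ([curvature_normsq_in_gram]), which is visibly measurable: the metrics
    are continuous, and the connection forms and their weak derivatives are
    measurable because the connection is locally in a Sobolev space. *)

(** * The tangent-line form of Jensen's inequality for the exponential *)

(** The graph of the exponential lies above its tangent at c and meets it only
    there; the case of equality is what yields almost-everywhere rigidity. *)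
Lemma expR_tangent (R : realType) (c x : R) :
  expR c * (1 + (x - c)) <= expR x ?= iff (x == c).
Proof.
have -> : expR x = expR c * expR (x - c) by rewrite -expRD addrC subrK.
have [->|xc] := eqVneq x c.
  by rewrite subrr addr0 expR0; split; rewrite ?lexx ?eqxx.
have lt : 1 + (x - c) < expR (x - c) by rewrite expR_gt1Dx// subr_eq0.
split; first by rewrite ler_pM2l ?expR_gt0// ltW.
by apply/negbTE; rewrite lt_eqF// ltr_pM2l ?expR_gt0.
Qed.

(** Integrating the tangent-line inequality, with the gap kept as a term of its
    own so that both the inequality and its equality case can be read off.  The
    hypothesis on [(expR c - 1)%:E * mu setT] replaces finiteness of [mu]: when
    c = 0 it holds for every measure. *)
Lemma integral_expR_tangent d (T : measurableType d) (R : realType)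
    (mu : {measure set T -> \bar R}) (f : T -> R) (c : R) :
  measurable_fun [set: T] f -> (forall x, 0 <= f x) -> 0 <= c ->
  ((expR c - 1)%:E * mu [set: T] < +oo)%E ->
  (c%:E * mu [set: T] <= \int[mu]_x (f x)%:E)%E ->
  (\int[mu]_x (expR (f x) - expR c * (1 + (f x - c)))%:E
     + (expR c - 1)%:E * mu [set: T]
   <= \int[mu]_x (expR (f x) - 1)%:E)%E.
Proof.
move=> mf f0 c0 finB le_cV.
pose V := mu [set: T].
have V0 : (0 <= V)%E by exact: measure_ge0.
have ec0 : 0 <= expR c - 1 by rewrite subr_ge0 -expR0 ler_expR.
have finC : (c%:E * V)%E \is a fin_num.
  rewrite ge0_fin_numE ?mule_ge0// ?lee_fin//.
  apply: le_lt_trans finB; apply: lee_wpmul2r => //.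
  by rewrite lee_fin lerBrDl expR_ge1Dx.
have mexp : measurable_fun [set: T] (fun x => expR (f x)).
  exact: (measurableT_comp (@measurable_expR R)).
have mgap : measurable_fun [set: T]
    (fun x => expR (f x) - expR c * (1 + (f x - c))).
  apply: measurable_funB => //; apply: measurable_funM => //.
  by apply: measurable_funD => //; apply: measurable_funB.
have gap0 x : 0 <= expR (f x) - expR c * (1 + (f x - c)).
  by rewrite subr_ge0 (expR_tangent c (f x)).1.
have ef0 x : 0 <= expR (f x) - 1 by rewrite subr_ge0 -expR0 ler_expR.
(* Both sides are arranged so that every integrand is nonnegative: the integral
   is then additive without any integrability hypothesis. *)
have split_int : (\int[mu]_x (expR (f x) - 1)%:E + (expR c * c)%:E * V =
    \int[mu]_x (expR (f x) - expR c * (1 + (f x - c)))%:E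
    + (expR c - 1)%:E * V + (expR c)%:E * \int[mu]_x (f x)%:E)%E.
  have mE (u : T -> R) : measurable_fun [set: T] u ->
      measurable_fun [set: T] (fun x => (u x)%:E) by move/measurable_EFinP.
  rewrite -!integral_cst// -ge0_integralZl_EFin ?expR_ge0//; last 2 first.
  - by move=> x _; rewrite ?lee_fin.
  - exact: mE.
  rewrite -!ge0_integralD//.
  - by apply: eq_integral => x _; rewrite -?EFinM -?EFinD; congr EFin; ring.
  - by move=> x _; rewrite lee_fin addr_ge0.
  - by apply: mE; apply: measurable_funD.
  - by move=> x _; rewrite -EFinM lee_fin mulr_ge0// expR_ge0.
  - by apply: mE; apply: measurable_funM.
  - by move=> x _; rewrite lee_fin.
  - exact: mE.
  - by move=> x _; rewrite lee_fin.
  - by apply: mE; apply: measurable_funB.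
  - by move=> x _; rewrite lee_fin mulr_ge0// expR_ge0.
have finC' : ((expR c * c)%:E * V)%E \is a fin_num.
  by rewrite EFinM -muleA fin_numM.
rewrite -(leeD2rE _ _ finC') split_int leeD2l// EFinM -muleA.
by apply: lee_wpmul2l => //; rewrite lee_fin expR_ge0.
Qed.

Lemma expR_jensen d (T : measurableType d) (R : realType)
    (mu : {measure set T -> \bar R}) (f : T -> R) (c : R) :
  measurable_fun [set: T] f -> (forall x, 0 <= f x) -> 0 <= c ->
  ((expR c - 1)%:E * mu [set: T] < +oo)%E ->
  (c%:E * mu [set: T] <= \int[mu]_x (f x)%:E)%E ->
  ((expR c - 1)%:E * mu [set: T] <= \int[mu]_x (expR (f x) - 1)%:E)%E.
Proof.
move=> mf f0 c0 finB le_cV.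
apply: le_trans (integral_expR_tangent mf f0 c0 finB le_cV).
rewrite leeDr// integral_ge0// => x _.
by rewrite lee_fin subr_ge0 (expR_tangent c (f x)).1.
Qed.

Lemma expR_jensen_eq d (T : measurableType d) (R : realType)
    (mu : {measure set T -> \bar R}) (f : T -> R) (c : R) :
  measurable_fun [set: T] f -> (forall x, 0 <= f x) -> 0 <= c ->
  ((expR c - 1)%:E * mu [set: T] < +oo)%E ->
  (c%:E * mu [set: T] <= \int[mu]_x (f x)%:E)%E ->
  (\int[mu]_x (expR (f x) - 1)%:E <= (expR c - 1)%:E * mu [set: T])%E ->
  {ae mu, forall x, f x = c}.
Proof.
move=> mf f0 c0 finB le_cV le_exp.
have gap0 x : 0 <= expR (f x) - expR c * (1 + (f x - c)).
  by rewrite subr_ge0 (expR_tangent c (f x)).1.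
have mgap : measurable_fun [set: T]
    (fun x => (expR (f x) - expR c * (1 + (f x - c)))%:E).
  apply/measurable_EFinP; apply: measurable_funB.
    exact: (measurableT_comp (@measurable_expR R)).
  apply: measurable_funM => //.
  by apply: measurable_funD => //; apply: measurable_funB.
have ec0 : 0 <= expR c - 1 by rewrite subr_ge0 -expR0 ler_expR.
have finB' : ((expR c - 1)%:E * mu [set: T])%E \is a fin_num.
  by rewrite ge0_fin_numE ?mule_ge0 ?lee_fin.
have int_gap_ge0 :
    (0 <= \int[mu]_x (expR (f x) - expR c * (1 + (f x - c)))%:E)%E.
  by apply: integral_ge0 => x _; rewrite lee_fin.
have int_gap :
    (\int[mu]_x `|(expR (f x) - expR c * (1 + (f x - c)))%:E| = 0)%E.
  under eq_integral do rewrite gee0_abs ?lee_fin//.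
  apply/eqP; rewrite eq_le int_gap_ge0 andbT.
  rewrite -(leeD2rE _ _ finB') add0e.
  exact: le_trans (integral_expR_tangent mf f0 c0 finB le_cV) le_exp.
move/(ae_eq_integral_abs _ measurableT mgap) : int_gap.
apply: filterS => x /(_ I) [] /eqP.
by rewrite subr_eq0 eq_sym (expR_tangent c (f x)).2 => /eqP.
Qed.

(** * Orthonormal bases and the curvature norm in coordinates *)

(** One step of Gram-Schmidt: the transvection [L] clears the first row and
    column outside the corner, leaving the Schur complement [G'], which is again
    symmetric and positive definite. *)
Lemma exists_orthonormal_basis (R : rcfType) n (G : 'M[R]_n) :
  G^T = G -> (forall v : 'rV[R]_n, v != 0 -> 0 < (v *m G *m v^T) 0 0) ->
  exists P : 'M[R]_n, P *m G *m P^T = 1%:M.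
Proof.
elim: n G => [|n IHn] G symG posG.
  by exists 0; rewrite [LHS]flatmx0 [RHS]flatmx0.
rewrite -[n.+1]/(1 + n)%N in G symG posG *.
pose a := G 0 0; pose w := ursubmx G; pose C := drsubmx G.
have Ga : ulsubmx G = a%:M.
  by rewrite [LHS]mx11_scalar !mxE; congr (G _ _)%:M; apply/val_inj.
have GE : G = block_mx a%:M w w^T C.
  by rewrite -[LHS]submxK Ga -/w -/C trmx_ursub symG.
have a_gt0 : 0 < a.
  have := posG (delta_mx 0 0 : 'rV[R]_(1 + n)).
  rewrite -rowE trmx_delta -colE !mxE; apply; apply/eqP => /matrixP/(_ 0 0).
  by rewrite !mxE !eqxx => /eqP; rewrite oner_eq0.
have a_neq0 := lt0r_neq0 a_gt0.
have symC : C^T = C by rewrite /C trmx_drsub symG.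
pose G' := C - a^-1 *: (w^T *m w).
pose L : 'M[R]_(1 + n) := block_mx 1%:M 0 (- a^-1 *: w^T) 1%:M.
have LG : L *m G *m L^T = block_mx a%:M 0 0 G'.
  rewrite GE /L tr_block_mx !mulmx_block !trmx1 !trmx0.
  rewrite !(mul1mx, mul0mx, mulmx1, mulmx0, addr0, add0r).
  have -> : (- a^-1 *: w^T)^T = - a^-1 *: w by rewrite linearZ/= trmxK.
  rewrite mul_mx_scalar mul_scalar_mx !scalerA mulrN mulfV//.
  rewrite !scaleN1r !addNr mul0mx add0r.
  by rewrite -scalemxAl scaleNr addrC.
have symG' : G'^T = G'.
  by rewrite /G' linearB/= linearZ/= trmx_mul trmxK symC.
have posG' (v : 'rV[R]_n) : v != 0 -> 0 < (v *m G' *m v^T) 0 0.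
  move=> v0; have vE : v *m G' *m v^T =
      (row_mx 0 v *m L) *m G *m (row_mx 0 v *m L)^T.
    rewrite trmx_mul !mulmxA -(mulmxA _ L) -(mulmxA _ (L *m G)) LG.
    rewrite mul_row_block tr_row_mx mul_row_col.
    by rewrite !(mul0mx, mulmx0, addr0, add0r, trmx0).
  rewrite vE; apply: posG; apply: contra_neq v0.
  rewrite mul_row_block mul0mx add0r mul0mx add0r mulmx1.
  by rewrite -[RHS]row_mx0 => /eq_row_mx[].
have [P' P'E] := IHn G' symG' posG'.
exists (block_mx (Num.sqrt a)^-1%:M 0 0 P' *m L).
rewrite trmx_mul !mulmxA -(mulmxA _ L) -(mulmxA _ (L *m G)) LG.
rewrite tr_block_mx !mulmx_block.
rewrite !(mul0mx, mulmx0, addr0, add0r, trmx0) P'E tr_scalar_mx.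
rewrite -!scalar_mxM -[X in (_ * X * _)%:M](sqr_sqrtr (ltW a_gt0)).
rewrite [_ * _ * _](_ : _ = 1) -?scalar_mx_block//.
by have : Num.sqrt a != 0 by [rewrite gt_eqF// sqrtr_gt0]; move=> ?; field.
Qed.

(** Whichever orthonormal basis is chosen, the sum of its tensor squares is the
    inverse metric.  This removes the arbitrary choice from the curvature
    norm. *)
Lemma orthonormal_basis_gram (R : realType) n (G : 'M[R]_n) :
  G^T = G -> (forall v : 'rV[R]_n, v != 0 -> 0 < (v *m G *m v^T) 0 0) ->
  (orthonormal_basis G)^T *m orthonormal_basis G = invmx G.
Proof.
move=> symG posG; set P := orthonormal_basis G.
have PG : P *m G *m P^T = 1%:M.
  exact: (xgetPex 0 (exists_orthonormal_basis symG posG)).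
have PG' : P^T *m (P *m G) = 1%:M by apply: mulmx1C.
have GU : G \in unitmx.
  by move: PG'; rewrite mulmxA => /mulmx1_unit[].
by rewrite -[RHS]mul1mx -PG' mulmxA mulmxK.
Qed.

Lemma hom_inner_sum (R : realType) r (H : 'M[R]_r) (I : finType)
    (c : I -> R) (K : I -> 'M[R]_r) :
  hom_inner H (\sum_i c i *: K i) (\sum_i c i *: K i) =
  \sum_i \sum_j c i * c j * hom_inner H (K i) (K j).
Proof.
rewrite /hom_inner [(\sum_i _)^T]linear_sum/= [invmx H *m _]mulmx_sumr !mulmx_suml.
rewrite [LHS]linear_sum/=; apply: eq_bigr => i _.
rewrite mulmx_sumr [LHS]linear_sum/=; apply: eq_bigr => j _.
rewrite [(c i *: _)^T]linearZ/= -scalemxAr -[invmx H *m _]scalemxAr.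
by rewrite -!scalemxAl !linearZ/= mulrCA mulrA.
Qed.

Lemma hom_innerNN (R : realType) r (H S : 'M[R]_r) :
  hom_inner H (- S) (- S) = hom_inner H S S.
Proof. by rewrite /hom_inner [(- S)^T]linearN/= !(mulmxN, mulNmx) opprK. Qed.

Lemma sum_lt_symmetric (R : numFieldType) n (q : 'I_n -> 'I_n -> R) :
  (forall a b, q a b = q b a) -> (forall a, q a a = 0) ->
  \sum_(a < n) \sum_(b < n | (a < b)%N) q a b =
  2^-1 * \sum_(a < n) \sum_(b < n) q a b.
Proof.
move=> qC q0.
have -> : \sum_(a < n) \sum_(b < n) q a b =
    \sum_(a < n) \sum_(b < n | (a < b)%N) q a b
    + \sum_(a < n) \sum_(b < n | (b < a)%N) q a b.
  rewrite -big_split/=; apply: eq_bigr => a _.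
  rewrite (bigID (fun b : 'I_n => (a < b)%N))/=; congr (_ + _).
  rewrite [RHS]big_mkcond [LHS]big_mkcond/=; apply: eq_bigr => b _.
  by rewrite -leqNgt; case: ltngtP => // /val_inj ->.
have -> : \sum_(a < n) \sum_(b < n | (b < a)%N) q a b =
    \sum_(a < n) \sum_(b < n | (a < b)%N) q a b.
  rewrite (exchange_big_dep xpredT)//=; apply: eq_bigr => a _.
  by apply: eq_bigr => b _; rewrite qC.
by field.
Qed.

(** The squared norm of an alternating form [K], computed in a basis [P], depends
    on [P] only through [P^T *m P].  Alternation turns the sum over pairs a < b
    into half of the sum over all pairs, on which the basis indices can be
    contracted. *)
Lemma sum_hom_inner_basis (R : realType) n r (H : 'M[R]_r) (P : 'M[R]_n)
    (K : 'I_n -> 'I_n -> 'M[R]_r) :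
  (forall k l, K l k = - K k l) ->
  let S a b := \sum_(k < n) \sum_(l < n) (P a k * P b l) *: K k l in
  \sum_(a < n) \sum_(b < n | (a < b)%N) hom_inner H (S a b) (S a b) =
  2^-1 * \sum_(p : 'I_n * 'I_n) \sum_(q : 'I_n * 'I_n)
    (P^T *m P) p.1 q.1 * (P^T *m P) p.2 q.2
    * hom_inner H (K p.1 p.2) (K q.1 q.2).
Proof.
move=> KN S.
have SN a b : S b a = - S a b.
  rewrite /S exchange_big/= -sumrN; apply: eq_bigr => k _.
  rewrite -sumrN; apply: eq_bigr => l _.
  by rewrite KN scalerN mulrC.
have S0 a : S a a = 0.
  apply/eqP; have /eqP := SN a a; rewrite -addr_eq0 -mulr2n -scaler_nat.
  by rewrite scaler_eq0 pnatr_eq0.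
rewrite sum_lt_symmetric; last 2 first.
- by move=> a b; rewrite SN hom_innerNN.
- by move=> a; rewrite S0 /hom_inner mulmx0 mxtrace0.
congr (_ * _); rewrite pair_bigA/=.
under eq_bigr do rewrite /S pair_bigA/= hom_inner_sum.
rewrite exchange_big/=; apply: eq_bigr => p _.
rewrite exchange_big/=; apply: eq_bigr => q _.
rewrite -mulr_suml; congr (_ * _).
rewrite !mxE big_distrlr/= pair_bigA/=; apply: eq_bigr => s _.
by rewrite !mxE; ring.
Qed.

(** * Measurability of the curvature norm *)

(** Real powers of exponent -1 agree with the inverse on nonnegative numbers, 0
    included, which reduces the claim to measurability of powers. *)
Lemma measurable_invr (R : realType) : measurable_fun [set: R] (@GRing.inv R).
Proof.
have -> : @GRing.inv R = fun x => x * (x ^+ 2) `^ (-1).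
  apply/funext => x; rewrite powR_inv1 ?sqr_ge0//.
  have [->|x0] := eqVneq x 0; first by rewrite invr0 mul0r.
  by rewrite expr2 invfM mulrA mulfV// mul1r.
apply: measurable_funM => //.
apply: (measurableT_comp (f := fun y : R => y `^ (-1))).
  exact: measurable_powR.
exact: measurable_funX.
Qed.

Lemma measurable_sqrtr (R : realType) : measurable_fun [set: R] (@Num.sqrt R).
Proof.
by apply: nondecreasing_measurable => // x y; exact: ler_wsqrtr.
Qed.

Section measurable_matrix.
Context d (T : measurableType d) (R : realType) (A : set T).

(** Entrywise measurability spares a sigma-algebra on rectangular matrices. *)
Definition measurable_mx p q (F : T -> 'M[R]_(p, q)) :=
  forall i j, measurable_fun A (fun x => F x i j).

Lemma measurable_mulmx p q s (F : T -> 'M[R]_(p, q)) (G : T -> 'M[R]_(q, s)) :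
  measurable_mx F -> measurable_mx G -> measurable_mx (fun x => F x *m G x).
Proof.
move=> mF mG i j; under eq_fun do rewrite mxE.
by apply: measurable_sum => k; apply: measurable_funM; [exact: mF|exact: mG].
Qed.

Lemma measurable_trmx p q (F : T -> 'M[R]_(p, q)) :
  measurable_mx F -> measurable_mx (fun x => (F x)^T).
Proof. by move=> mF i j; under eq_fun do rewrite mxE; exact: mF. Qed.

Lemma measurable_addmx p q (F G : T -> 'M[R]_(p, q)) :
  measurable_mx F -> measurable_mx G -> measurable_mx (fun x => F x + G x).
Proof.
move=> mF mG i j; under eq_fun do rewrite mxE.
by apply: measurable_funD; [exact: mF|exact: mG].
Qed.

Lemma measurable_oppmx p q (F : T -> 'M[R]_(p, q)) :
  measurable_mx F -> measurable_mx (fun x => - F x).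
Proof.
move=> mF i j; under eq_fun do rewrite mxE.
by apply: measurable_funN; exact: mF.
Qed.

Lemma measurable_mxtrace p (F : T -> 'M[R]_p) :
  measurable_mx F -> measurable_fun A (fun x => \tr (F x)).
Proof. by move=> mF; apply: measurable_sum => i; exact: mF. Qed.

Lemma measurable_determinant p (F : T -> 'M[R]_p) :
  measurable_mx F -> measurable_fun A (fun x => \det (F x)).
Proof.
move=> mF; apply: measurable_sum => s; apply: measurable_funM => //.
by apply: measurable_prod => i _; exact: mF.
Qed.

Lemma measurable_adjugate p (F : T -> 'M[R]_p) :
  measurable_mx F -> measurable_mx (fun x => \adj (F x)).
Proof.
move=> mF i j; under eq_fun do rewrite mxE.
apply: measurable_funM => //; apply: measurable_determinant => k l.
by under eq_fun do rewrite !mxE; exact: mF.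
Qed.

Lemma measurable_invmx p (F : T -> 'M[R]_p) : measurable A ->
  measurable_mx F -> measurable_mx (fun x => invmx (F x)).
Proof.
move=> mA mF i j.
(* Where the determinant vanishes, [invmx] is the identity by convention. *)
rewrite (_ : (fun x => _) = fun x => if \det (F x) == 0 then F x i j
    else (\det (F x))^-1 * \adj (F x) i j); last first.
  apply/funext => x; rewrite /invmx unitmxE unitfE.
  by case: eqP => //= _; rewrite mxE.
have mdet := measurable_determinant mF.
apply: measurable_fun_if => //.
- exact: measurable_fun_eqr.
- by apply: measurable_funS (mF i j) => //; exact: subIsetl.
- apply: (measurable_funS mA); first exact: subIsetl.
  apply: measurable_funM; last exact: (measurable_adjugate mF).
  exact: (measurableT_comp (@measurable_invr R)).
Qed.

Lemma measurable_hom_inner p (H S U : T -> 'M[R]_p) : measurable A ->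
  measurable_mx H -> measurable_mx S -> measurable_mx U ->
  measurable_fun A (fun x => hom_inner (H x) (S x) (U x)).
Proof.
move=> mA mH mS mU; apply: measurable_mxtrace; apply: measurable_mulmx => //.
apply: measurable_mulmx => //; apply: measurable_mulmx.
  exact: measurable_invmx.
exact: measurable_trmx.
Qed.

End measurable_matrix.

Lemma continuous_on_open_measurable (S : ptopologicalType)
    (S' : ptopologicalType) (A : set S) (f : S -> S') :
  open A -> (forall x, A x -> {for x, continuous f}) ->
  measurable_fun (A : set (borel S)) (f : borel S -> borel S').
Proof.
move=> oA cf.
apply: (@measurability _ _ (borel S) (borel S') A f (@open S')) => //= _ [U oU <-].
apply: sub_sigma_algebra => /=.
rewrite openE => x [Ax Ufx]; rewrite /interior.
apply: filterI; first exact: open_nbhs_nbhs.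
by apply: cf => //; exact: open_nbhs_nbhs.
Qed.

(** The Borel sets of a real type are generated by intervals rather than declared
    as the sigma-algebra of the open sets, hence a separate lemma. *)
Lemma continuous_on_open_measurableR (R : realType) (S : ptopologicalType)
    (A : set S) (f : S -> R) :
  open A -> (forall x, A x -> {for x, continuous f}) ->
  measurable_fun (A : set (borel S)) (f : borel S -> R).
Proof.
move=> oA cf.
apply: (measurability _ (RGenOpens.measurableE R)) => _ [_ [a [b ->]] <-].
apply: sub_sigma_algebra => /=.
rewrite openE => x [Ax Ufx]; rewrite /interior.
apply: filterI; first exact: open_nbhs_nbhs.
by apply: cf => //; apply: open_nbhs_nbhs; split=> //; exact: interval_open.
Qed.

Section curvature_norm_measurable.
Context (R : realType) (M : ptopologicalType) (n : nat)
  (X : smooth_atlas R M n) (g : riemannian_metric X)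
  (r : nat) (E : vector_bundle X r) (h : fiber_metric E).
Implicit Types (D : connection E) (i : chart X).

(** The curvature endomorphism of two coordinate vector fields. *)
Definition curvature_component D i (y : 'rV[R]_n) (k l : 'I_n) : 'M[R]_r :=
  cform_partial D i k l y - cform_partial D i l k y
  + cform D i k y *m cform D i l y - cform D i l y *m cform D i k y.

Lemma cimg_cmap i x : cdom i x -> cimg i (cmap i x).
Proof. by exists x. Qed.

(** The coordinate expression of the norm: two indices are raised with the inverse
    metric, and no basis appears any more. *)
Lemma curvature_normsq_in_gram D i x : cdom i x ->
  curvature_normsq_in g h D i x =
  2^-1 * \sum_(p : 'I_n * 'I_n) \sum_(q : 'I_n * 'I_n)
    invmx (gmx g i (cmap i x)) p.1 q.1 * invmx (gmx g i (cmap i x)) p.2 q.2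
    * hom_inner (gram h i x)
        (curvature_component D i (cmap i x) p.1 p.2)
        (curvature_component D i (cmap i x) q.1 q.2).
Proof.
move=> /cimg_cmap ix; rewrite /curvature_normsq_in /=.
set y := cmap i x; set e := orthonormal_basis _.
rewrite -(orthonormal_basis_gram (gmx_sym g ix) (gmx_posdef g ix)) -/y -/e.
rewrite -sum_hom_inner_basis; last first.
  move=> k l; rewrite /curvature_component.
  by rewrite -[LHS]addrA -[in RHS]addrA opprD !opprB.
apply: eq_bigr => a _; apply: eq_bigr => b _.
suff -> : curvature D i y (row a e) (row b e) =
  \sum_(k < n) \sum_(l < n) (e a k * e b l) *: curvature_component D i y k l.
  by [].
by apply: eq_bigr => k _; apply: eq_bigr => l _; rewrite !mxE.
Qed.

Lemma measurable_cdom i : measurable (cdom i : set (borel M)).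
Proof. by apply: sub_sigma_algebra; exact: open_cdom. Qed.

Lemma continuous_cmap_at i x : cdom i x -> {for x, continuous (cmap i)}.
Proof.
move=> ix; have := @continuous_cmap _ _ _ X i.
by rewrite continuous_open_subspace; [apply; rewrite inE|exact: open_cdom].
Qed.

Lemma measurable_comp_cmap i (u : borel 'rV[R]_n -> R) :
  measurable_fun (cimg i : set (borel 'rV[R]_n)) u ->
  measurable_fun (cdom i : set (borel M)) (fun x => u (cmap i x)).
Proof.
move=> mu; apply: (@measurable_comp _ _ _ _ (borel 'rV[R]_n) _ (cimg i) u) => //.
- by apply: sub_sigma_algebra; exact: open_cimg.
- exact: (continuous_on_open_measurable (@open_cdom _ _ _ X i)
    (@continuous_cmap_at i)).
Qed.

Lemma measurable_smooth_mx i p (G : 'rV[R]_n -> 'M[R]_p) :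
  smooth_on (cimg i) G ->
  measurable_mx (cdom i : set (borel M)) (fun x => G (cmap i x)).
Proof.
move=> sG a b; apply: (@measurable_comp_cmap i (fun y => G y a b)).
apply: (continuous_on_open_measurableR (@open_cimg _ _ _ X i)) => y iy.
apply: (@continuous_comp _ _ _ G (fun N : 'M[R]_p => N a b)).
  exact: (sG 0%N).
exact: coord_continuous.
Qed.

(** The chosen representative of a weak derivative is measurable since the Sobolev
    hypothesis provides some weak derivative, so that the choice does not fall
    back on its default. *)
Lemma measurable_cform_partial D i k l : sobolev_connection 1 D ->
  measurable_mx (cdom i : set (borel M))
    (fun x => cform_partial D i k l (cmap i x)).
Proof.
move=> sD a b; under eq_fun do rewrite mxE.
apply: measurable_comp_cmap.
have [_ /(_ k)[v vP _]] := sD i l a b.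
by have [_ [] ] := xgetPex (cst 0) (ex_intro _ v vP).
Qed.

Lemma measurable_cform D i k : sobolev_connection 1 D ->
  measurable_mx (cdom i : set (borel M)) (fun x => cform D i k (cmap i x)).
Proof.
move=> sD a b; apply: (@measurable_comp_cmap i (fun y => cform D i k y a b)).
by have [[]] := sD i k a b.
Qed.

Lemma measurable_curvature_component D i k l : sobolev_connection 1 D ->
  measurable_mx (cdom i : set (borel M))
    (fun x => curvature_component D i (cmap i x) k l).
Proof.
move=> sD; apply: measurable_addmx; first apply: measurable_addmx.
- apply: measurable_addmx; first exact: measurable_cform_partial.
  by apply: measurable_oppmx; exact: measurable_cform_partial.
- by apply: measurable_mulmx; exact: measurable_cform.
- by apply: measurable_oppmx; apply: measurable_mulmx; exact: measurable_cform.
Qed.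

Lemma measurable_curvature_normsq_in D i : sobolev_connection 1 D ->
  measurable_fun (cdom i : set (borel M)) (curvature_normsq_in g h D i).
Proof.
move=> sD; have mi := measurable_cdom i.
have mginv : measurable_mx (cdom i : set (borel M))
    (fun x => invmx (gmx g i (cmap i x))).
  apply: measurable_invmx => //; apply: measurable_smooth_mx.
  exact: gmx_smooth.
have mh : measurable_mx (cdom i : set (borel M)) (gram h i).
  move=> a b; have := measurable_smooth_mx (@smooth_gram _ _ _ _ _ _ h i) a b.
  by apply: eq_measurable_fun => x; rewrite inE => ix; rewrite cmapK.
apply: (eq_measurable_fun _ (fun x xi =>
  esym (curvature_normsq_in_gram D (set_mem xi)))).
apply: measurable_funM => //; apply: measurable_sum => p.
apply: measurable_sum => q; apply: measurable_funM.
  by apply: measurable_funM; exact: mginv.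
by apply: measurable_hom_inner => //; exact: measurable_curvature_component.
Qed.

(** The chart picked at a point is a function of the set of charts that contain
    the point.  The manifold is thus cut into finitely many Borel cells, on each
    of which a single chart is used. *)
Lemma measurable_curvature_norm D : sobolev_connection 1 D ->
  measurable_fun [set: borel M] (curvature_norm g h D).
Proof.
move=> sD.
pose cell (b : {ffun chart X -> bool}) : set (borel M) :=
  \bigcap_(i in [set: chart X]) [set x | `[< cdom i x >] = b i].
have mcell b : measurable (cell b).
  apply: fin_bigcap_measurable => // i _; case: (b i).
  - rewrite (_ : [set x | _] = cdom i); first exact: measurable_cdom.
    by apply/seteqP; split => x /=; [move/asboolP|move=> ?; exact/asboolP].
  - rewrite (_ : [set x | _] = ~` cdom i).
      by apply: measurableC; exact: measurable_cdom.
    by apply/seteqP; split => x /=; [move/asboolPn|move=> ?; exact/asboolPn].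
move=> _ Y mY; rewrite setTI.
rewrite (_ : _ @^-1` Y =
  \bigcup_(b in [set: {ffun chart X -> bool}])
    (cell b `&` curvature_norm g h D @^-1` Y)); last first.
  apply/seteqP; split => [x Yx|x [b _ []]//].
  by exists [ffun i => `[< cdom i x >]] => //; split=> // i _ /=; rewrite ffunE.
apply: fin_bigcup_measurable => // b _.
suff : measurable_fun (cell b) (curvature_norm g h D) by apply.
have normE x : cell b x -> curvature_norm g h D x =
    if [pick i | b i] is Some i
    then Num.sqrt (curvature_normsq_in g h D i x) else 0.
  by move=> bx; rewrite /curvature_norm; under eq_pick do rewrite (bx _ I).
apply: (eq_measurable_fun _ (fun x xb => esym (normE x (set_mem xb)))).
case: pickP => [i bi|_]; last exact: measurable_cst.
apply: (measurableT_comp (@measurable_sqrtr R)).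
apply: (@measurable_funS _ _ _ _ (cdom i : set (borel M))).
- exact: measurable_cdom.
- by move=> x /(_ i I)/=; rewrite bi => /asboolP.
- exact: measurable_curvature_normsq_in.
Qed.

End curvature_norm_measurable.

(** * Minimizers *)

Lemma curvature_norm_ge0 (R : realType) (M : ptopologicalType) (n : nat)
    (X : smooth_atlas R M n) (g : riemannian_metric X) (r : nat)
    (E : vector_bundle X r) (h : fiber_metric E) (D : connection E) (x : M) :
  0 <= curvature_norm g h D x.
Proof. by rewrite /curvature_norm; case: pickP => // i _; exact: sqrtr_ge0. Qed.

Unset Implicit Arguments.

Theorem theorem9p2 (R : realType) (M : ptopologicalType) (n : nat)
    (X : smooth_atlas R M n) (hausM : hausdorff_space M)
    (compM : compact [set: M]) (g : riemannian_metric X)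
    (vol : {measure set (borel M) -> \bar R})
    (volM : is_riemannian_volume g vol)
    (r : nat) (E : vector_bundle X r) (h : fiber_metric E)
    (D : connection E) :
  is_minimizer g h vol (YM g h vol) D ->
  ae_constant_curvature_norm g h vol D ->
  is_minimizer g h vol (YMe0 g h vol) D /\
  (forall D' : connection E, is_minimizer g h vol (YMe0 g h vol) D' ->
     ae_constant_curvature_norm g h vol D').
Proof.
move=> [[sD YMe_fin] YM_min] [c normD].
pose f (D' : connection E) (x : borel M) := 2^-1 * curvature_norm g h D' x ^+ 2.
pose c0 := 2^-1 * c ^+ 2.
have mf D' : W_space g h vol D' -> measurable_fun [set: borel M] (f D').
  move=> [sD' _]; apply: measurable_funM => //; apply: measurable_funX.
  by apply: measurable_curvature_norm; exact: sD'.
have f0 D' x : 0 <= f D' x by rewrite mulr_ge0 ?invr_ge0 ?sqr_ge0.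
have c00 : 0 <= c0 by rewrite mulr_ge0 ?invr_ge0 ?sqr_ge0.
have WD : W_space g h vol D by [].
(* The functionals at D are the integrals of [u (f D)] for u the identity and
   for u = expR - 1. *)
have int_const (u : R -> R) : measurable_fun [set: R] u ->
    (forall t, 0 <= t -> 0 <= u t) ->
    (\int[vol]_x (u (f D x))%:E = (u c0)%:E * vol [set: M])%E.
  move=> mu u0; rewrite -integral_cst//.
  apply: ge0_ae_eq_integral => //.
  - apply/measurable_EFinP; apply: (measurableT_comp mu); exact: mf.
  - by move=> x _; rewrite lee_fin u0.
  - by move=> x _; rewrite lee_fin u0.
  - by apply: (@filterS _ _ (ae_filter_ringOfSetsType vol) _ _ _ normD) => x xc _;
      rewrite /f xc.
have YMD : YM g h vol D = (c0%:E * vol [set: M])%E by exact: (int_const id).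
have YMeD : YMe0 g h vol D = ((expR c0 - 1)%:E * vol [set: M])%E.
  apply: (int_const (fun t => expR t - 1)).
  - by apply: measurable_funB.
  - by move=> t t0; rewrite subr_ge0 -expR0 ler_expR.
have finB : ((expR c0 - 1)%:E * vol [set: borel M] < +oo)%E.
  by move: YMe_fin; rewrite YMeD.
have le_YM D' : W_space g h vol D' ->
    (c0%:E * vol [set: borel M] <= \int[vol]_x (f D' x)%:E)%E.
  move=> WD'; have <- := YMD; rewrite YM_min; apply: ereal_inf_lbound.
  by exists D'.
have minD : is_minimizer g h vol (YMe0 g h vol) D.
  split=> //; apply/eqP; rewrite eq_le; apply/andP; split; last first.
    by apply: ereal_inf_lbound; exists D.
  apply: le_ereal_inf_tmp => _ [D' WD' <-].
  rewrite YMeD; exact: expR_jensen (mf _ WD') (f0 D') c00 finB (le_YM _ WD').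
split=> // D' [WD' minD'].
have le_YMe : (\int[vol]_x (expR (f D' x) - 1)%:E <=
    (expR c0 - 1)%:E * vol [set: borel M])%E.
  by have <- := YMeD; rewrite (proj2 minD) -minD'.
(* The curvature norm is nonnegative, so it is recovered from its square; the
   constant [c] may be negative if the volume is zero. *)
exists `|c|.
apply: (@filterS _ _ (ae_filter_ringOfSetsType vol)) _ _ _
  (expR_jensen_eq (mf _ WD') (f0 D') c00 finB (le_YM _ WD') le_YMe) => x.
rewrite /f /c0 => /(mulfI (invr_neq0 (lt0r_neq0 (ltr0Sn R 1)))) eq2.
apply/eqP; rewrite -(@eqrXn2 _ 2) ?curvature_norm_ge0//.
by rewrite eq2 real_normK// num_real.
Qed.
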